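(* Every $n$-vertex $4$-graph with $e\ge n^{4-1/216}$ edges contains $\frac{1}{24}(e/n)^{1/4}$ vertex-disjoint copies of the complete $4$-partite $4$-graph $K_4(s,s,s,t)$, where $s=\frac{1}{12}\Big(\frac{\log n}{\log(n^4/e)}\Big)^{1/3}$ and $t=n^{1/4}$.
   Context: A $4$-graph is a $4$-uniform hypergraph. $K_4(a_1,a_2,a_3,a_4)$ is the complete $4$-partite $4$-graph with vertex classes of sizes $a_1,\dots,a_4$, whose edges are all $4$-sets with one vertex in each class. Non-integer quantities are rounded (floors and ceilings omitted); $n$ is assumed sufficiently large. *)

(* Defs.v *)
From HB Require Import structures.
From mathcomp Require Import all_boot all_order all_algebra.
From mathcomp Require Import all_classical all_reals all_analysis.

Set Implicit Arguments.
Unset Strict Implicit.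
Unset Printing Implicit Defensive.

Import Order.TTheory GRing.Theory Num.Theory.

Record hypergraph (k : nat) (V : finType) := Hypergraph {
  edges : {set {set V}};
  edges_uniform : forall A : {set V}, A \in edges -> #|A| = k }.

(* Vertex class i of the complete k-partite k-graph with class sizes a is the
   fibre over i of the tagged type {i & 'I_(a i)}. *)
Definition multipartite_edges (k : nat) (a : 'I_k -> nat) :
    {set {set {i : 'I_k & 'I_(a i)}}} :=
  [set A : {set {i : 'I_k & 'I_(a i)}}
     | [forall i, #|[set x in A | tag x == i]| == 1]].

Lemma multipartite_edges_uniform (k : nat) (a : 'I_k -> nat)
    (A : {set {i : 'I_k & 'I_(a i)}}) :
  A \in multipartite_edges a -> #|A| = k.
Proof.
rewrite inE => /forallP oneA.
rewrite -sum1_card (partition_big (fun x => tag x) predT) //=.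
rewrite (eq_bigr (fun=> 1)) => [|i _]; first by rewrite sum1_card card_ord.
rewrite -[RHS](eqP (oneA i)) -sum1_card.
by apply: eq_bigl => x; rewrite inE.
Qed.

Definition complete_multipartite (k : nat) (a : 'I_k -> nat) :
    hypergraph k {i : 'I_k & 'I_(a i)} :=
  Hypergraph (@multipartite_edges_uniform k a).

Definition K4 (a1 a2 a3 a4 : nat) :=
  complete_multipartite (fun i : 'I_4 => nth 0 [:: a1; a2; a3; a4] i).

(* Copies are not required to be induced. *)
Definition is_copy (k : nat) (W V : finType) (F : hypergraph k W)
    (H : hypergraph k V) (f : W -> V) : Prop :=
  injective f /\ forall A : {set W}, A \in edges F -> f @: A \in edges H.

Definition has_disjoint_copies (m k : nat) (W V : finType)
    (F : hypergraph k W) (H : hypergraph k V) : Prop :=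
  exists f : 'I_m -> W -> V,
    (forall j, is_copy F H (f j)) /\
    (forall (j j' : 'I_m) (x y : W), j != j' -> f j x != f j' y).

(* Real-valued sizes and counts are rounded up. This is the strongest rounding:
   a copy with larger classes contains one with smaller classes. *)
Definition nceil (R : realType) (x : R) : nat := `|Num.ceil x|%N.

(* Main.v *)
(* Put q = n^4/e >= 24, S = nceil s and g = e^(1/4).  The hypothesis on e makes
   s >= 1/2, so that rounding up at most doubles s and q^(216 S^3) <= n.

   The copies are chosen greedily, but the vertices used in the large classes
   could meet most edges if they had large degree.  So the large classes are
   taken among the vertices of degree less than 4 g^3: at most g vertices
   violate this, hence at most g^4/24 = e/24 edges consist of such vertices only,
   and the at most g/12 vertices used in large classes lie in at most e/3 edges.
   The vertices used in small classes are few enough to use the trivial degree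
   bound n^3.  Thus at least e/2 edges are still available at each step.

   To find a copy, the class of size S is chosen one coordinate at a time: if a
   relation has density 1/q, the power mean inequality yields S vertices whose
   common neighbourhood has density at least q^(-2S).  After three rounds at least
   n (2q)^(-8 S^3) vertices remain for the large class. *)

Require Import Defs.
From HB Require Import structures.
From mathcomp Require Import all_boot all_order all_algebra.
From mathcomp Require Import all_classical all_reals all_analysis.
From mathcomp Require Import ring lra zify.

Set Implicit Arguments.
Unset Strict Implicit.
Unset Printing Implicit Defensive.

Import Order.TTheory GRing.Theory Num.Theory.

Local Open Scope ring_scope.

(** * Power means and falling factorials *)

(** Convexity: a power lies above its tangent at [d]. In the induction, [a] times the old tangent
    exceeds the new tangent by (k+1) d^k (a - d)^2. *)
Lemma expr_tangent (R : realDomainType) (a d : R) (k : nat) :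
  0 <= a -> 0 <= d ->
  d ^+ k.+1 + k.+1%:R * d ^+ k * (a - d) <= a ^+ k.+1.
Proof.
move=> a0 d0; elim: k => [|k IHk]; first by rewrite !expr1 expr0; lra.
rewrite exprS [leRHS]exprS.
apply: le_trans (ler_wpM2l a0 IHk).
rewrite -subr_ge0.
have -> : a * (d ^+ k.+1 + k.+1%:R * d ^+ k * (a - d)) -
    (d * d ^+ k.+1 + k.+2%:R * d ^+ k.+1 * (a - d)) =
    k.+1%:R * d ^+ k * (a - d) ^+ 2.
  by rewrite !exprS expr0 -[k.+2%:R]natr1; ring.
by apply: mulr_ge0 (sqr_ge0 _); rewrite mulr_ge0 ?exprn_ge0 ?ler0n.
Qed.

(** Sum the tangents at [d]: the linear terms have a nonnegative total because the average of [a] is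
    at least [d]. *)
Lemma power_mean (R : realDomainType) (I : finType) (a : I -> R) (d : R)
    (k : nat) :
  0 <= d -> (forall i, 0 <= a i) -> #|I|%:R * d <= \sum_i a i ->
  #|I|%:R * d ^+ k <= \sum_i a i ^+ k.
Proof.
move=> d0 a0 le_avg; case: k => [|k].
  under eq_bigr do rewrite expr0.
  by rewrite expr0 mulr1 sumr_const.
have /le_trans -> // : #|I|%:R * d ^+ k.+1 <=
    \sum_i (d ^+ k.+1 + k.+1%:R * d ^+ k * (a i - d)).
  rewrite big_split /= sumr_const -[X in _ <= X + _]mulr_natl lerDl -mulr_sumr.
  rewrite mulr_ge0 ?mulr_ge0 ?exprn_ge0 ?ler0n //.
  by rewrite sumrB sumr_const subr_ge0 -[d *+ _]mulr_natl.
by apply: ler_sum => i _; apply: expr_tangent.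
Qed.

Lemma ffact_le_exp (n k : nat) : (n ^_ k <= n ^ k)%N.
Proof.
elim: k => [|k IHk]; first by rewrite ffactn0.
by rewrite ffactnSr expnSr leq_mul // leq_subr.
Qed.

(* The factor n avoids the exponent s - 1 in k ^ s <= k ^_ s + s ^ 2 * n ^ (s - 1). *)
Lemma expn_le_ffact (n k s : nat) : (k <= n)%N ->
  (n * k ^ s <= n * k ^_ s + s ^ 2 * n ^ s)%N.
Proof.
move=> le_kn; elim: s => [|s IHs]; first by rewrite ffactn0 expn0 leq_addr.
rewrite ffactnSr !expnSr !mulnA.
have h1 : (n * k ^ s * k <= (n * k ^_ s + s ^ 2 * n ^ s) * k)%N.
  by rewrite leq_mul2r IHs orbT.
have h2 : (k ^_ s <= n ^ s)%N.
  by apply: leq_trans (ffact_le_exp _ _) _; case: (s) => // s'; rewrite leq_exp2r.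
apply: leq_trans h1 _.
have h3 : (n * k ^_ s * k <= n * k ^_ s * (k - s) + s * n * k ^_ s)%N.
  have : (k <= (k - s) + s)%N by lia.
  by move=> /(leq_mul (leqnn (n * k ^_ s)%N)); lia.
have h4 : (s * n * k ^_ s <= s * n * n ^ s)%N by rewrite leq_mul.
have h5 : (s ^ 2 * n ^ s * k <= s ^ 2 * n ^ s * n)%N by rewrite leq_mul.
(* The errors from [h4] and [h5] fit because s + s^2 <= (s + 1)^2. *)
rewrite mulnDl expn0 mul1n; nia.
Qed.

(** * Common neighbourhoods in dense relations *)

Definition common_nbrs (V Y : finType) (A : {set V * Y}) (X : {set V}) :
    {set Y} := [set y | [forall x in X, (x, y) \in A]].

(** Double counting of the pairs (X, y) with X an [s]-subset of the neighbourhood of y. *)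
Lemma sum_common_nbrs (V Y : finType) (A : {set V * Y}) (s : nat) :
  (\sum_(X : {set V} | #|X| == s) #|common_nbrs A X| =
   \sum_y 'C(#|[set x | (x, y) \in A]|, s))%N.
Proof.
under [LHS]eq_bigr do rewrite -sum1_card big_mkcond /=.
rewrite exchange_big /=; apply: eq_bigr => y _.
rewrite -cards_draws -sum1_card -big_mkcondr /=; apply: eq_bigl => X.
rewrite !inE andbC; congr (_ && _).
apply/forall_inP/idP => [h|/fintype.subsetP h x /h]; last by rewrite inE.
by apply/fintype.subsetP => x /h; rewrite inE.
Qed.

(** The best [X] does at least as well as the average. Power means bound the number of all
    [s]-tuples of neighbours from below; tuples with repeated entries are absorbed by the lower
    bound on [#|V|], at the price of q^(2s) in place of q^s. *)
Lemma exists_common_nbrs (R : realFieldType) (V Y : finType)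
    (A : {set V * Y}) (q : R) (s : nat) :
  (0 < s)%N -> 2 <= q -> s%:R ^+ 2 * q ^+ (2 * s) <= #|V|%:R ->
  #|V|%:R * #|Y|%:R <= q * #|A|%:R ->
  exists2 X : {set V}, #|X| = s &
    #|Y|%:R <= q ^+ (2 * s) * #|common_nbrs A X|%:R.
Proof.
move=> s0 q2 le_n dense.
have q0 : 0 < q by lra.
have qs2 : 2 <= q ^+ s.
  case: s s0 {le_n} => // s _; rewrite exprS.
  have : 1 <= q ^+ s by rewrite exprn_ege1 //; lra.
  nra.
have s_le : (s <= #|V|)%N.
  rewrite -(ler_nat R); apply: le_trans le_n.
  have : 1 <= (s%:R : R) by rewrite ler1n.
  move=> s1; have Q1 : 1 <= q ^+ (2 * s) by rewrite exprn_ege1 //; lra.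
  have : (s%:R : R) <= s%:R ^+ 2 by nra.
  move/le_trans; apply; rewrite ler_peMr // sqr_ge0 //.
have [X0 X0s] : exists X : {set V}, #|X| == s.
  have : (0 < #|[set X : {set V} | #|X| == s]|)%N.
    by rewrite card_draws bin_gt0.
  by case/card_gt0P => X; rewrite inE; exists X.
pose c X := #|common_nbrs A X|.
(* [X0] only shows that the maximum is over a nonempty family. *)
case: (@arg_maxnP _ X0 (fun X : {set V} => #|X| == s) c X0s) => X /eqP Xs maxX.
exists X => //; rewrite -/(c X).
set n := #|V| in dense le_n s_le *.
have n0 : (0 < n)%N by lia.
pose deg y := #|[set x | (x, y) \in A]|.
have deg_le y : (deg y <= n)%N by apply: max_card.
have sum_deg : (\sum_y deg y = #|A|)%N.
  rewrite -sum1_card (partition_big snd predT) //=; apply: eq_bigr => y _.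
  have pair_inj : injective (fun x : V => (x, y)) by move=> x1 x2 [].
  rewrite sum1_card /deg -(card_imset _ pair_inj).
  apply: eq_card => -[x y']; rewrite [in RHS]unfold_in /=.
  apply/imsetP/andP => [[x']|[xA /eqP yy]].
    by rewrite inE => ? [-> ->].
  by subst y'; exists x => //; rewrite inE.
(* Falling factorials count injective [s]-tuples of neighbours, and each [s]-set contributes at most
   the maximum [c X]. *)
have upper : (\sum_y (deg y) ^_ s <= n ^ s * c X)%N.
  under eq_bigr do rewrite -bin_ffact.
  rewrite -big_distrl /= -sum_common_nbrs.
  apply: (@leq_trans ('C(n, s) * c X * s`!)).
    rewrite leq_mul2r; apply/orP; right.
    apply: (@leq_trans (\sum_(X' : {set V} | #|X'| == s) c X)).
      exact: leq_sum.
    by rewrite sum_nat_const -card_draws cardsE.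
  by rewrite mulnAC bin_ffact leq_mul2r ffact_le_exp orbT.
have nat_ineq : (n * \sum_y deg y ^ s <= n * (n ^ s * c X) + #|Y| * (s ^ 2 * n ^ s))%N.
  apply: (@leq_trans (\sum_y (n * deg y ^_ s + s ^ 2 * n ^ s))%N).
    by rewrite big_distrr; apply: leq_sum => y _; apply: expn_le_ffact.
  rewrite big_split /= sum_nat_const leq_add2r -big_distrr /=.
  by rewrite leq_mul2l upper orbT.
have mean : #|Y|%:R * (n%:R / q) ^+ s <= \sum_y (deg y)%:R ^+ s.
  apply: power_mean => [|y|]; rewrite ?ler0n //.
    by rewrite divr_ge0 ?ler0n // ltW.
  rewrite -natr_sum sum_deg mulrA ler_pdivrMr // [leRHS]mulrC; nra.
have nR : 0 < n%:R :> R by rewrite ltr0n.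
have ns0 : 0 < n%:R ^+ s :> R by rewrite exprn_gt0.
have main : n%:R * (#|Y|%:R * (n%:R ^+ s / q ^+ s)) <=
    n%:R * (n%:R ^+ s * (c X)%:R) + #|Y|%:R * (s%:R ^+ 2 * n%:R ^+ s) :> R.
  rewrite -expr_div_n; apply: le_trans (ler_wpM2l (ltW nR) mean) _.
  move: nat_ineq; rewrite -(ler_nat R) !(natrD, natrM, natrX) natr_sum.
  by under eq_bigr do rewrite natrX.
set Q := q ^+ s in qs2 main *; set N := n%:R ^+ s in ns0 main *.
have {}main : n%:R * #|Y|%:R <= Q * (n%:R * (c X)%:R + #|Y|%:R * s%:R ^+ 2) :> R.
  rewrite -ler_pdivrMl; last by lra.
  rewrite -(ler_pM2l ns0); apply: le_trans (le_trans main _).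
    by rewrite le_eqVlt; apply/orP; left; apply/eqP; ring.
  by rewrite le_eqVlt; apply/orP; left; apply/eqP; ring.
rewrite mulnC exprM -/Q in le_n *.
have Y0 : 0 <= #|Y|%:R :> R by rewrite ler0n.
(* A second factor Q turns the error into s^2 Q^2 #|Y| <= n #|Y|, which is at most half of the left
   side since Q >= 2. *)
have {}main : Q * (n%:R * #|Y|%:R) <=
    Q ^+ 2 * (n%:R * (c X)%:R) + #|Y|%:R * n%:R.
  apply: le_trans (ler_wpM2l _ main) _; first by lra.
  have := ler_wpM2l Y0 le_n; rewrite -/n; nra.
rewrite -(ler_pM2l nR).
have := mulr_ge0 (ltW nR) Y0; nra.
Qed.

(** Three rounds, each fixing the first remaining coordinate and raising the inverse density to the
    power 2s: q, q^(2s), q^(4s^2), q^(8s^3). The size condition for the last round implies the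
    earlier ones. *)
Lemma dense_tuples (R : realFieldType) (V : finType)
    (N : {set V * (V * (V * V))}) (q : R) (s : nat) :
  (0 < s)%N -> 2 <= q -> s%:R ^+ 2 * q ^+ (8 * s ^ 3) <= #|V|%:R ->
  #|V|%:R ^+ 4 <= q * #|N|%:R ->
  exists X Y Z W : {set V},
    [/\ #|X| = s, #|Y| = s, #|Z| = s,
        #|V|%:R <= q ^+ (8 * s ^ 3) * #|W|%:R &
        forall x y z w, x \in X -> y \in Y -> z \in Z -> w \in W ->
          (x, (y, (z, w))) \in N].
Proof.
move=> s0 q2 le_n dense.
have q1 : 1 <= q by apply: le_trans q2; rewrite ler1n.
have q0 : 0 <= q := le_trans ler01 q1.
set n : R := #|V|%:R in le_n dense *.
have le_q k : (0 < k)%N -> 2 <= q ^+ k.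
  by case: k => // k _; apply: le_trans q2 _; rewrite exprS ler_peMr ?exprn_ege1.
have s2 : 0 <= s%:R ^+ 2 :> R := sqr_ge0 _.
have le_n_small k : (k <= 8 * s ^ 3)%N -> s%:R ^+ 2 * q ^+ k <= n.
  move=> le_k; apply: le_trans le_n; apply: ler_wpM2l => //.
  by rewrite ler_weXn2l.
have e8 : (8 * s ^ 3 = 2 * s * (2 * s) * (2 * s))%N by ring.
have k1 : (2 * s <= 8 * s ^ 3)%N.
  by rewrite e8 leq_pmull // !muln_gt0 s0.
have k2 : (2 * s * (2 * s) <= 8 * s ^ 3)%N.
  by rewrite e8 leq_pmulr // !muln_gt0 s0.
have [||X Xs dX] := exists_common_nbrs (A := N) s0 q2.
- exact: le_n_small.
- by rewrite !card_prod !natrM -/n; apply: le_trans dense; rewrite !exprS expr0 mulr1.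
have [|||Y Ys dY] := exists_common_nbrs (A := common_nbrs N X) (q := q ^+ (2 * s)) s0.
- by apply: le_q; rewrite muln_gt0.
- by rewrite -exprM; apply: le_n_small.
- by apply: le_trans dX; rewrite !card_prod !natrM.
have [|||Z Zs dZ] := exists_common_nbrs
    (A := common_nbrs (common_nbrs N X) Y) (q := q ^+ (2 * s * (2 * s))) s0.
- by apply: le_q; rewrite !muln_gt0 s0.
- by rewrite -exprM; apply: le_n_small; rewrite e8.
- by move: dY; rewrite -exprM card_prod natrM.
exists X, Y, Z, (common_nbrs (common_nbrs (common_nbrs N X) Y) Z); split=> //.
  by move: dZ; rewrite -exprM e8.
move=> x y z w xX yY zZ; rewrite inE => /forall_inP/(_ z zZ).
by rewrite inE => /forall_inP/(_ y yY); rewrite inE => /forall_inP/(_ x xX).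
Qed.

(** * From families of transversal edges to copies *)

(** If x lay in two of the sets, a transversal using x for both would have fewer than [k]
    elements. *)
Lemma transversal_disjoint (k : nat) (V : finType) (P : 'I_k -> {set V}) :
  (forall i, 0 < #|P i|)%N ->
  (forall v : 'I_k -> V, (forall i, v i \in P i) -> #|[set v i | i : 'I_k]| = k) ->
  forall i j x, x \in P i -> x \in P j -> i = j.
Proof.
move=> P0 cardP i j x xi xj; apply/eqP/negPn/negP => neq_ij.
pose pick l := xchoose (card_gt0P (P0 l)).
pose v l := if (l == i) || (l == j) then x else pick l.
have vP l : v l \in P l.
  rewrite /v; case: eqP => [->|_] //; case: eqP => [->|_] //=.
  exact: (xchooseP (card_gt0P (P0 l))).
have := cardP v vP; rewrite -[RHS]card_ord => /eqP/finset.imset_injP inj.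
by move/eqP: neq_ij; apply; apply: inj; rewrite // /v /= !eqxx orbT.
Qed.

(** Class i is mapped to the first [a i] elements of [P i]. Injectivity across classes is not
    assumed: it follows from uniformity, the sets [P i] being nonempty. *)
Lemma blowup_is_copy (k : nat) (V : finType) (H : hypergraph k V)
    (a : 'I_k -> nat) (P : 'I_k -> {set V}) :
  (forall i, 0 < a i <= #|P i|)%N ->
  (forall v : 'I_k -> V, (forall i, v i \in P i) ->
     [set v i | i : 'I_k] \in edges H) ->
  exists f : {i : 'I_k & 'I_(a i)} -> V,
    is_copy (complete_multipartite a) H f /\ forall x, f x \in P (tag x).
Proof.
move=> aP PH.
have aP2 i : (a i <= #|P i|)%N by case/andP: (aP i).
pose f (x : {i : 'I_k & 'I_(a i)}) := enum_val (widen_ord (aP2 (tag x)) (tagged x)).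
have fP x : f x \in P (tag x) by apply: enum_valP.
have disj : forall i j x, x \in P i -> x \in P j -> i = j.
  apply: transversal_disjoint => [i|v vP]; last exact: edges_uniform (PH v vP).
  by case/andP: (aP i); apply: leq_trans.
exists f; split=> //; split=> [x y fxy|A].
  have := disj _ _ _ (fP x); rewrite fxy => /(_ _ (fP y)).
  case: x y fxy => [i u] [j w] /= fxy eij; subst j.
  by move/enum_val_inj: fxy => [] /val_inj ->.
rewrite inE => /forallP oneA.
have ex i : exists x, x \in [set x in A | tag x == i].
  by apply/card_gt0P; rewrite (eqP (oneA i)).
pose u i := xchoose (ex i).
have uA i : u i \in A /\ tag (u i) = i.
  by have := xchooseP (ex i); rewrite inE => /andP[? /eqP].
(* An edge of the pattern consists of exactly one point [u i] per class, so its image is a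
   transversal. *)
have -> : f @: A = [set f (u i) | i : 'I_k].
  apply/setP => y; apply/imsetP/imsetP => [[x xA ->]|[i _ ->]].
    exists (tag x) => //; congr f.
    have /eqP/cards1P[z zE] := eqP (oneA (tag x)).
    have : x \in [set z] by rewrite -zE inE xA eqxx.
    have : u (tag x) \in [set z] by rewrite -zE inE; case: (uA (tag x)) => -> ->; rewrite eqxx.
    by rewrite !inE => /eqP -> /eqP.
  by exists (u i) => //; case: (uA i).
by apply: PH => i; rewrite -{2}(uA i).2.
Qed.

Lemma leq_card_bigcup (I T : finType) (P : pred I) (F : I -> {set T}) :
  (#|\bigcup_(i | P i) F i| <= \sum_(i | P i) #|F i|)%N.
Proof.
elim/big_rec2: _ => [|i k A _ leA]; first by rewrite cards0.
by rewrite (leq_trans (leq_card_setU _ _)) ?leq_add2l.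
Qed.

(** The last coordinate is the one that will range over the large class, hence the condition on it
    alone. If members of [F] have four elements, the entries are automatically distinct. *)
Definition quadruples (V : finType) (F : {set {set V}}) (L : {set V}) :
    {set V * (V * (V * V))} :=
  [set p | ([set p.1; p.2.1; p.2.2.1; p.2.2.2] \in F) && (p.2.2.2 \in L)].

(** Each member of [F] has an ordering that ends in [L], so forgetting the order maps the quadruples
    onto a family containing [F]. *)
Lemma card_le_quadruples (V : finType) (F : {set {set V}}) (L : {set V}) :
  (forall E, E \in F -> #|E| = 4) ->
  (forall E, E \in F -> exists2 x, x \in E & x \in L) ->
  (#|F| <= #|quadruples F L|)%N.
Proof.
move=> F4 FL.
pose set_of (p : V * (V * (V * V))) := [set p.1; p.2.1; p.2.2.1; p.2.2.2].
apply: leq_trans (leq_imset_card set_of _).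
apply/subset_leq_card/fintype.subsetP => E EF; apply/imsetP.
have [w wE wL] := FL E EF.
have : #|E :\ w| = 3 by have := cardsD1 w E; rewrite wE F4 // => -[].
move=> E3; have /card_gt0P[x xE] : (0 < #|E :\ w|)%N by rewrite E3.
have E2 : #|E :\ w :\ x| = 2 by have := cardsD1 x (E :\ w); rewrite xE E3 => -[].
have /eqP/cards2P[y [z [_ Eyz]]] := E2.
have defE : E = [set x; y; z; w].
  rewrite -(finset.setD1K wE) -(finset.setD1K xE) Eyz.
  by apply/setP => u; rewrite !inE orbC !orbA.
by exists (x, (y, (z, w))); rewrite // inE /= -defE EF wL.
Qed.

Lemma imset_ord4 (V : finType) (v : 'I_4 -> V) :
  [set v i | i : 'I_4] =
  [set v (inord 0); v (inord 1); v (inord 2); v (inord 3)].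
Proof.
apply/setP => y; rewrite !inE -!orbA; apply/imsetP/idP => [[i _ ->]|].
  have -> : i = inord i by rewrite inord_val.
  by case: i => -[|[|[|[|]]]] //= _; rewrite eqxx ?orbT.
by case/or4P => /eqP ->; [exists (inord 0)|exists (inord 1)|exists (inord 2)|exists (inord 3)].
Qed.

Lemma dense_has_copy (R : realFieldType) (V : finType) (H : hypergraph 4 V)
    (F : {set {set V}}) (L U : {set V}) (q : R) (s t : nat) :
  F \subset edges H ->
  (forall E, E \in F -> exists2 x, x \in E & x \in L) ->
  (forall E x, E \in F -> x \in E -> x \notin U) ->
  (0 < s)%N -> (0 < t)%N -> 2 <= q ->
  s%:R ^+ 2 * q ^+ (8 * s ^ 3) <= #|V|%:R ->
  t%:R * q ^+ (8 * s ^ 3) <= #|V|%:R ->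
  #|V|%:R ^+ 4 <= q * #|F|%:R ->
  exists f, [/\ is_copy (K4 s s s t) H f,
    (forall x, nat_of_ord (tag x) = 3 -> f x \in L) & forall x, f x \notin U].
Proof.
move=> FH FL FU s0 t0 q2 le_ns le_nt dense.
have q1 : 1 <= q by apply: le_trans q2; rewrite ler1n.
have q0 : 0 <= q := le_trans ler01 q1.
have F4 E : E \in F -> #|E| = 4.
  by move=> /(fintype.subsetP FH)/edges_uniform.
have [|X [Y [Z [W [Xs Ys Zs Wt N]]]]] := dense_tuples (N := quadruples F L) s0 q2 le_ns.
  apply: le_trans dense (ler_wpM2l q0 _); rewrite ler_nat.
  exact: card_le_quadruples.
have {}Wt : (t <= #|W|)%N.
  rewrite -(ler_nat R) -(ler_pM2l (_ : 0 < q ^+ (8 * s ^ 3))).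
    by apply: le_trans Wt; rewrite mulrC.
  by rewrite exprn_gt0 // (lt_le_trans ltr01).
pose P (i : 'I_4) := nth finset.set0 [:: X; Y; Z; W] i.
have PF v : (forall i, v i \in P i) -> [set v i | i : 'I_4] \in F /\ v (inord 3) \in L.
  move=> vP; have := N (v (inord 0)) (v (inord 1)) (v (inord 2)) (v (inord 3)).
  rewrite inE -imset_ord4 /= => Nv; apply/andP; apply: Nv.
  - by have := vP (inord 0); rewrite /P inordK.
  - by have := vP (inord 1); rewrite /P inordK.
  - by have := vP (inord 2); rewrite /P inordK.
  - by have := vP (inord 3); rewrite /P inordK.
have P0 (i : 'I_4) : (0 < nth 0%N [:: s; s; s; t] i <= #|P i|)%N.
  by rewrite /P; case: i => -[|[|[|[|]]]] //= _; rewrite ?Xs ?Ys ?Zs ?s0 ?t0 ?leqnn.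
have [|f [f_copy fP]] := @blowup_is_copy 4 V H _ P P0.
  by move=> v vP; apply: (fintype.subsetP FH); case: (PF v vP).
have P1 i : (0 < #|P i|)%N by case/andP: (P0 i); apply: leq_trans.
pose pick i := xchoose (card_gt0P (P1 i)).
(* Every vertex of the copy extends to a transversal, hence lies in a member of [F]; this is how it
   avoids [U] and, in the last class, falls in [L]. *)
have ext x : exists v : 'I_4 -> V, (forall i, v i \in P i) /\ v (tag x) = f x.
  exists (fun i => if i == tag x then f x else pick i); split; last by rewrite eqxx.
  move=> i; case: eqP => [->|_] //; exact: (xchooseP (card_gt0P (P1 i))).
exists f; split=> // x; have [v [vP <-]] := ext x; have [vF vL] := PF v vP.
  by move=> x3; rewrite -[tag x]inord_val x3.
by apply: FU vF _; apply: imset_f.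
Qed.

(** * Degrees and surviving edges *)

(** Deleting [v] maps its edges injectively to triples. *)
Lemma edges_at_le (V : finType) (H : hypergraph 4 V) (v : V) :
  (#|[set E in edges H | v \in E]| <= #|V| ^ 3)%N.
Proof.
pose D := [set E in edges H | v \in E].
have inj : {in D &, injective (fun E : {set V} => E :\ v)}.
  move=> E E'; rewrite !inE => /andP[_ vE] /andP[_ vE'] EE'.
  by rewrite -(finset.setD1K vE) EE' finset.setD1K.
rewrite -(card_in_imset inj).
apply: (@leq_trans #|[set E : {set V} | #|E| == 3]|).
  apply/subset_leq_card/fintype.subsetP => _ /imsetP[E ED ->].
  move: ED; rewrite !inE => /andP[/edges_uniform E4 vE].
  by have := cardsD1 v E; rewrite vE E4 add1n => -[<-].
rewrite card_draws; apply: leq_trans (ffact_le_exp _ _).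
by rewrite -bin_ffact leq_pmulr // fact_gt0.
Qed.

Lemma sum_degrees (k : nat) (V : finType) (H : hypergraph k V) :
  (\sum_v #|[set E in edges H | v \in E]| = k * #|edges H|)%N.
Proof.
under eq_bigr do rewrite -sum1_card big_mkcond /=.
rewrite exchange_big /= mulnC -sum_nat_const [RHS]big_mkcond /=.
apply: eq_bigr => E _; case: (boolP (E \in edges H)) => EH.
  rewrite -[in RHS](edges_uniform EH) -sum1_card [RHS]big_mkcond.
  by apply: eq_bigr => v _; rewrite inE EH.
by rewrite big1 // => v _; rewrite inE (negbTE EH).
Qed.

Definition low_degree (R : realFieldType) (k : nat) (V : finType)
    (H : hypergraph k V) (D : R) : {set V} :=
  [set v | #|[set E in edges H | v \in E]|%:R < D].

(** The degrees sum to 4 g^4, and each exceptional vertex accounts for at least 4 g^3 of this. *)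
Lemma card_high_degree (R : realFieldType) (V : finType)
    (H : hypergraph 4 V) (g : R) :
  0 < g -> g ^+ 4 = #|edges H|%:R ->
  #|~: low_degree H (4 * g ^+ 3)|%:R <= g.
Proof.
move=> g0 g4; set L := low_degree H _.
have : #|~: L|%:R * (4 * g ^+ 3) <= 4 * g ^+ 4.
  rewrite g4 -natrM -sum_degrees natr_sum.
  apply: (@le_trans _ _ (\sum_(v in ~: L) (4 * g ^+ 3))).
    by rewrite sumr_const mulr_natl.
  rewrite big_mkcond /=; apply: ler_sum => v _; case: ifP => [|_] //.
  by rewrite !inE -leNgt.
have -> : 4 * g ^+ 4 = g * (4 * g ^+ 3) by rewrite [g ^+ 4]exprS; ring.
by rewrite ler_pM2r // mulr_gt0 // exprn_gt0.
Qed.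

(** Union bound over three kinds of lost edges: those missing [L], of which there are at most
    g^4/24, those meeting [A], charged the trivial degree, and those meeting [B], charged the low
    degree. *)
Lemma many_surviving_edges (R : realFieldType) (V : finType)
    (H : hypergraph 4 V) (g : R) (A B : {set V}) :
  0 < g -> g ^+ 4 = #|edges H|%:R ->
  let L := low_degree H (4 * g ^+ 3) in
  B \subset L ->
  #|edges H|%:R <=
    #|[set E in edges H | ~~ [disjoint E & L] && [disjoint E & A :|: B]]|%:R
    + #|edges H|%:R / 24 + #|A|%:R * #|V|%:R ^+ 3 + #|B|%:R * (4 * g ^+ 3).
Proof.
move=> g0 g4 L BL; set F := [set E in edges H | _].
pose star v := [set E in edges H | v \in E].
pose high := [set E : {set V} | E \subset ~: L & #|E| == 4].
have cover : (#|edges H| <= #|F| + #|high| + \sum_(v in A) #|star v| + \sum_(v in B) #|star v|)%N.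
  have sub : edges H \subset F :|: high :|: \bigcup_(v in A) star v :|: \bigcup_(v in B) star v.
    apply/fintype.subsetP => E EH; rewrite 3!finset.in_setU.
    case: (boolP [disjoint E & L]) => EL.
      suff -> : E \in high by rewrite orbT.
      by rewrite inE (edges_uniform EH) eqxx andbT -finset.disjoints_subset.
    case: (boolP [disjoint E & A :|: B]) => EAB.
      by rewrite inE EH EL EAB.
    move: EAB; rewrite -finset.setI_eq0 => /finset.set0Pn[v]; rewrite !inE => /andP[vE].
    case/orP => [vA|vB]; last first.
      by apply/orP; right; apply/finset.bigcupP; exists v; rewrite // inE EH.
    apply/orP; left; apply/orP; right.
    by apply/finset.bigcupP; exists v; rewrite // inE EH.
  apply: leq_trans (subset_leq_card sub) _.
  apply: leq_trans (leq_card_setU _ _) _; apply: leq_add; last exact: leq_card_bigcup.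
  apply: leq_trans (leq_card_setU _ _) _; apply: leq_add; last exact: leq_card_bigcup.
  exact: leq_card_setU.
have highR : #|high|%:R <= #|edges H|%:R / 24 :> R.
  rewrite cards_draws ler_pdivlMr; last by rewrite ltr0n.
  have -> : 'C(#|~: L|, 4)%:R * 24 = (#|~: L| ^_ 4)%:R :> R by rewrite -bin_ffact natrM.
  rewrite -g4.
  apply: le_trans (_ : (#|~: L| ^ 4)%:R <= _).
    by rewrite ler_nat ffact_le_exp.
  by rewrite natrX lerXn2r ?nnegrE ?ler0n ?(ltW g0) ?card_high_degree.
have AR : (\sum_(v in A) #|star v|)%:R <= #|A|%:R * #|V|%:R ^+ 3 :> R.
  rewrite -natrX -natrM ler_nat -sum_nat_const.
  by apply: leq_sum => v _; apply: edges_at_le.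
have BR : (\sum_(v in B) #|star v|)%:R <= #|B|%:R * (4 * g ^+ 3) :> R.
  rewrite natr_sum mulr_natl -sumr_const; apply: ler_sum => v vB.
  by have := fintype.subsetP BL v vB; rewrite inE => /ltW.
move: cover; rewrite -(ler_nat R) !natrD => cover.
by apply: le_trans cover _; rewrite !lerD.
Qed.

(** * Greedy selection of disjoint copies *)

(** [T] is the part of the pattern to be embedded in [L]. Vertices already used are split into
    images of the complement of [T] (the set [A]) and of [T] (the set [B]), since the two are
    charged differently. *)
Lemma greedy_disjoint_copies (m k a b : nat) (W V : finType)
    (F : hypergraph k W) (H : hypergraph k V) (T : {set W}) (L : {set V}) :
  (#|~: T| <= a)%N -> (#|T| <= b)%N ->
  (forall A B : {set V}, (#|A| <= m * a)%N -> B \subset L -> (#|B| <= m * b)%N ->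
     exists f, [/\ is_copy F H f, (forall x, x \in T -> f x \in L) &
       forall x, f x \notin A :|: B]) ->
  has_disjoint_copies m F H.
Proof.
move=> Ta Tb step.
suff /(_ m (leqnn m)) [f [fc _ fd]] : forall j, (j <= m)%N ->
    exists f : 'I_j -> W -> V,
    [/\ forall i, is_copy F H (f i), forall i x, x \in T -> f i x \in L &
        forall (i i' : 'I_j) x y, i != i' -> f i x != f i' y].
  by exists f.
elim=> [_|j IHj lt_jm].
  have f0 (i : 'I_0) : W -> V by case: i.
  by exists f0; split; case.
have [f [fc fL fd]] := IHj (ltnW lt_jm).
pose used (S : {set W}) := \bigcup_(i : 'I_j) f i @: S.
have card_used (S : {set W}) c : (#|S| <= c)%N -> (#|used S| <= m * c)%N.
  move=> Sc; apply: leq_trans (leq_card_bigcup _ _) _.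
  apply: (@leq_trans (\sum_(i : 'I_j) c)).
    by apply: leq_sum => i _; apply: leq_trans (leq_imset_card _ _) Sc.
  by rewrite sum_nat_const card_ord leq_mul2r ltnW ?orbT.
have [|g [gc gL gd]] := step (used (~: T)) (used T) (card_used _ _ Ta) _ (card_used _ _ Tb).
  by apply/finset.bigcupsP => i _; apply/fintype.subsetP => _ /imsetP[x xT ->]; apply: fL.
have gf i x y : g x != f i y.
  apply: contraNneq (gd x) => ->; rewrite inE; case: (boolP (y \in T)) => yT.
    by apply/orP; right; apply/finset.bigcupP; exists i; rewrite ?imset_f.
  by apply/orP; left; apply/finset.bigcupP; exists i; rewrite ?imset_f // inE.
(* The new copy gets the last index. *)
exists (fun i => if unlift ord_max i is Some i' then f i' else g); split.
- by move=> i; case: unliftP.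
- by move=> i x; case: unliftP => [i' _|_]; [apply: fL|apply: gL].
- move=> i i' x y; case: unliftP => [l ->|->]; case: unliftP => [l' ->|->].
  + by rewrite (inj_eq lift_inj); apply: fd.
  + by move=> _; rewrite eq_sym gf.
  + by move=> _; apply: gf.
  + by rewrite eqxx.
Qed.

(** * Numerical bounds and assembly *)

(** Here r = n^(1/4), u = (e/n)^(1/4), so u r = e^(1/4), and p stands for q^(S^3). The first two
    bounds control lost edges; the last two are the size conditions for finding one copy. *)
Lemma parameter_bounds (R : realFieldType) (r u q p S T m : R) :
  24 <= q -> q <= p -> 1 <= S -> S <= p -> 0 <= r -> 0 <= u ->
  p ^+ 216 <= r ^+ 4 -> (r ^+ 4) ^+ 4 = q * (u * r) ^+ 4 ->
  0 <= T -> T <= r + 1 -> 0 <= m -> m <= u / 24 + 1 ->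
  [/\ m * (3 * S) * (r ^+ 4) ^+ 3 <= (u * r) ^+ 4 / 8,
      m * T * (4 * (u * r) ^+ 3) <= (u * r) ^+ 4 / 3,
      S ^+ 2 * p ^+ 16 <= r ^+ 4 & T * p ^+ 16 <= r ^+ 4].
Proof.
move=> q24 qp S1 Sp r0 u0 pr defq T0 Tr m0 mu.
have p24 : 24 <= p := le_trans q24 qp.
have p0 : 0 <= p by lra.
have q0 : 0 <= q by lra.
have ppow k l : (k <= l)%N -> p ^+ k <= p ^+ l by move=> kl; rewrite ler_weXn2l //; lra.
have r54 : p ^+ 54 <= r.
  by rewrite -(@ler_pXn2r _ 4) ?nnegrE ?exprn_ge0 // -exprM.
have pr2 : 2 * p ^+ 16 <= r.
  apply: le_trans r54; apply: le_trans (ppow 17 54 isT).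
  rewrite [p ^+ 17]exprS ler_wpM2r ?exprn_ge0 //; lra.
have pr1 : 2 * p ^+ 4 <= r.
  by apply: le_trans pr2; rewrite ler_wpM2l // ppow.
have p_le_r : p <= r.
  by apply: le_trans r54; apply: (ppow 1 54).
have r24 : 24 <= r by lra.
set g := u * r in defq *.
have g0 : 0 <= g by rewrite mulr_ge0.
(* Take fourth roots in n^4 = q g^4 <= p^4 g^4. *)
have pg : r ^+ 4 <= p * g.
  rewrite -(@ler_pXn2r _ 4) ?nnegrE ?exprn_ge0 ?mulr_ge0 // defq [(p * g) ^+ 4]exprMn.
  rewrite ler_wpM2r ?exprn_ge0 //.
  by apply: le_trans qp _; apply: (ppow 1 4).
have r30 k : 0 <= r ^+ k by rewrite exprn_ge0.
have u_r2 : r ^+ 2 <= u.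
  have r_gt0 : 0 < r by lra.
  rewrite -(ler_pM2r r_gt0) -/g -(ler_pM2l (_ : 0 < p)); last by lra.
  apply: le_trans pg; have -> : r ^+ 4 = r * (r ^+ 2 * r) by ring.
  by rewrite ler_wpM2r // mulr_ge0.
have u576 : 72 <= u by apply: le_trans u_r2; nra.
(* The roundings cost little: m <= u/18 since u >= 72, and T <= 25r/24 since r >= 24. *)
have mT : m * T <= g / 12.
  have : m * T <= (u / 18) * (25 / 24 * r) by apply: ler_pM => //; lra.
  have : u * r = g by [].
  lra.
(* Cube r^4 <= p g, spend one factor r on 2 p^4, and cancel p^3. *)
have g3 : 2 * p * r ^+ 11 <= g ^+ 3.
  have p3 : 0 < p ^+ 3 by rewrite exprn_gt0 //; lra.
  rewrite -(ler_pM2l p3).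
  have h : (r ^+ 4) ^+ 3 <= (p * g) ^+ 3.
    by rewrite ler_pXn2r ?nnegrE ?exprn_ge0 ?mulr_ge0.
  rewrite -exprMn; apply: le_trans h.
  have -> : (r ^+ 4) ^+ 3 = r * r ^+ 11 by ring.
  have -> : p ^+ 3 * (2 * p * r ^+ 11) = 2 * p ^+ 4 * r ^+ 11 by ring.
  by rewrite ler_wpM2r.
split.
- have m18 : m <= u / 18 by lra.
  have : m * (3 * S) * (r ^+ 4) ^+ 3 <= u / 18 * (3 * p) * (r ^+ 4) ^+ 3.
    rewrite ler_wpM2r // ?exprn_ge0 //; apply: ler_pM => //; lra.
  move/le_trans; apply.
  have -> : u / 18 * (3 * p) * (r ^+ 4) ^+ 3 = g / 12 * (2 * p * r ^+ 11).
    by rewrite /g; field.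
  have -> : g ^+ 4 / 8 = g / 8 * g ^+ 3 by field.
  apply: ler_pM => //; [lra| |lra].
  by rewrite !mulr_ge0.
- have -> : g ^+ 4 / 3 = g / 12 * (4 * g ^+ 3) by field.
  by rewrite ler_wpM2r // mulr_ge0 // exprn_ge0.
- have : S ^+ 2 * p ^+ 16 <= p ^+ 2 * p ^+ 16.
    by rewrite ler_wpM2r ?exprn_ge0 // ler_pXn2r ?nnegrE //; lra.
  rewrite -exprD => /le_trans; apply; apply: le_trans pr; exact: ppow.
- have : T * p ^+ 16 <= (2 * r) * (r / 2).
    by apply: ler_pM; rewrite ?exprn_ge0 //; lra.
  move/le_trans; apply.
  have -> : 2 * r * (r / 2) = r ^+ 2 by field.
  by rewrite ler_weXn2l //; lra.
Qed.

Lemma card_tag (k : nat) (a : 'I_k -> nat) (P : pred 'I_k) :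
  (#|[set x : {i : 'I_k & 'I_(a i)} | P (tag x)]| = \sum_(i | P i) a i)%N.
Proof.
rewrite -sum1_card (partition_big (fun x => tag x) P) => [|x]; last by rewrite inE.
apply: eq_bigr => i Pi; rewrite sum1_card -[RHS]card_ord.
have inj : injective (fun j : 'I_(a i) => Tagged (fun i => 'I_(a i)) j).
  by move=> j j' /eqP; rewrite eq_Tagged => /eqP.
rewrite -(card_imset _ inj); apply: eq_card => -[i' j]; rewrite [in LHS]unfold_in /= inE /=.
apply/andP/imsetP => [[_ /eqP e]|[j' _ /(congr1 tag) /= ->]].
  by subst i'; exists j.
by rewrite Pi eqxx.
Qed.


Lemma card_last_class (s t : nat) :
  #|[set x : {i : 'I_4 & 'I_(nth 0%N [:: s; s; s; t] i)} | nat_of_ord (tag x) == 3]| = t.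
Proof.
rewrite (card_tag _ (fun i => nat_of_ord i == 3)) big_mkcond /=.
by rewrite !big_ord_recr big_ord0 /=.
Qed.

Lemma card_other_classes (s t : nat) :
  #|~: [set x : {i : 'I_4 & 'I_(nth 0%N [:: s; s; s; t] i)} | nat_of_ord (tag x) == 3]|
    = (3 * s)%N.
Proof.
have -> : ~: [set x : {i : 'I_4 & 'I_(nth 0%N [:: s; s; s; t] i)} | nat_of_ord (tag x) == 3]
    = [set x | nat_of_ord (tag x) != 3].
  by apply/finset.setP => x; rewrite !inE.
rewrite (card_tag _ (fun i => nat_of_ord i != 3)) big_mkcond /=.
rewrite !big_ord_recr big_ord0 /=; lia.
Qed.

Lemma disjoint_copies_of_bounds (R : realFieldType) (V : finType)
    (H : hypergraph 4 V) (r u q : R) (S T M : nat) :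
  let N : R := #|V|%:R in let E : R := #|edges H|%:R in
  let p := q ^+ (S ^ 3) in
  0 <= r -> r ^+ 4 = N -> 0 <= u -> u ^+ 4 = E / N ->
  0 < N -> 0 < E -> 24 <= q -> N ^+ 4 = q * E -> (0 < S)%N -> (0 < T)%N ->
  p ^+ 216 <= N -> T%:R <= r + 1 -> M%:R <= u / 24 + 1 ->
  has_disjoint_copies M (K4 S S S T) H.
Proof.
move=> N E p r0 r4 u0 u4 N0 E0 q24 defq S0 T0 pN Tr Mu.
have q0 : 0 < q by lra.
have g4 : (u * r) ^+ 4 = E by rewrite exprMn u4 r4 divfK // gt_eqF.
have qp : q <= p.
  rewrite /p -[leLHS]expr1 ler_weXn2l ?expn_gt0 ?S0 //; lra.
(* The chain is S <= 2^S <= q^S <= q^(S^3). *)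
have Sp : S%:R <= p.
  apply: (@le_trans _ _ (2 ^ S)%:R); first by rewrite ler_nat ltnW // ltn_expl.
  rewrite natrX; apply: (@le_trans _ _ (q ^+ S)).
    by rewrite lerXn2r ?nnegrE //; lra.
  rewrite ler_weXn2l //; first lra.
  by rewrite -[leqLHS]expn1 leq_pexp2l.
have [|||||||lossA lossB sS sT] := @parameter_bounds R r u q p S%:R T%:R M%:R q24 qp _ Sp r0 u0.
- by rewrite ler1n.
- by rewrite r4.
- by rewrite r4 g4.
- exact: ler0n.
- exact: Tr.
- exact: ler0n.
- exact: Mu.
have g_gt0 : 0 < u * r.
  rewrite lt0r mulr_ge0 // andbT; apply/eqP => g0.
  by move: E0; rewrite -g4 g0 expr0n ltxx.
pose L := low_degree H (4 * (u * r) ^+ 3).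
apply: (@greedy_disjoint_copies M 4 (3 * S) T _ V (K4 S S S T) H
  [set x | nat_of_ord (tag x) == 3] L).
- by rewrite card_other_classes.
- by rewrite card_last_class.
move=> A B cardA BL cardB.
have many := many_surviving_edges A g_gt0 g4 BL.
set F := [set X in edges H | _] in many.
(* The losses add up to 1/24 + 1/8 + 1/3 = 1/2. *)
have Flarge : E / 2 <= #|F|%:R.
  have hA : #|A|%:R * #|V|%:R ^+ 3 <= E / 8.
    rewrite -g4; apply: le_trans lossA; rewrite r4 ler_wpM2r ?exprn_ge0 ?(ltW N0) //.
    by rewrite -!natrM ler_nat.
  have hB : #|B|%:R * (4 * (u * r) ^+ 3) <= E / 3.
    rewrite -g4; apply: le_trans lossB; rewrite ler_wpM2r ?mulr_ge0 ?exprn_ge0 ?mulr_ge0 //.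
    by rewrite -natrM ler_nat.
  move: many; rewrite -/E; lra.
(* Keeping half of the edges replaces q by 2q, which is at most q^2. *)
have q8 : (2 * q) ^+ (8 * S ^ 3) <= p ^+ 16.
  have -> : p ^+ 16 = (q ^+ 2) ^+ (8 * S ^ 3).
    by rewrite /p -!exprM; congr (_ ^+ _); rewrite mulnA mulnC.
  rewrite lerXn2r ?nnegrE ?sqr_ge0 //; [lra|].
  by rewrite expr2 ler_wpM2r //; lra.
have [|||||||f [fc fL fU]] := @dense_has_copy R V H F L (A :|: B) (2 * q) S T _ _ _ S0 T0.
- by apply/fintype.subsetP => X; rewrite inE => /andP[].
- move=> X; rewrite inE => /and3P[_ + _]; rewrite -setI_eq0 => /finset.set0Pn[x].
  by rewrite inE => /andP[? ?]; exists x.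
- move=> X x; rewrite inE => /and3P[_ _ XU] xX.
  by rewrite (disjointFr XU).
- by lra.
- rewrite -/N -r4; apply: le_trans sS; by rewrite ler_wpM2l ?sqr_ge0.
- rewrite -/N -r4; apply: le_trans sT; by rewrite ler_wpM2l.
- by rewrite -/N defq; nra.
exists f; split=> // x; rewrite inE => /eqP; exact: fL.
Qed.

(** * Rounding, logarithms and the final choice of parameters *)

Lemma nceil_lt (R : realType) (x : R) : 0 <= x -> (nceil x)%:R < x + 1.
Proof.
move=> x0; have c0 : 0 <= Num.ceil x by rewrite ceil_ge0; lra.
have -> : (nceil x)%:R = (Num.ceil x)%:~R :> R.
  by rewrite /nceil natr_absz ger0_norm.
by have := ceilB1_lt x; rewrite intrB; lra.
Qed.

Lemma nceil_gt0 (R : realType) (x : R) : 0 < x -> (0 < nceil x)%N.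
Proof. by move=> x0; rewrite /nceil absz_gt0 gt_eqF // ceil_gt0. Qed.

Lemma card_edges_le (V : finType) (H : hypergraph 4 V) :
  (24 * #|edges H| <= #|V| ^ 4)%N.
Proof.
apply: leq_trans (ffact_le_exp _ _); rewrite -bin_ffact mulnC leq_mul2r -card_draws.
apply/orP; right; apply/subset_leq_card/fintype.subsetP => E /edges_uniform E4.
by rewrite inE E4.
Qed.

Theorem theorem5p8 (R : realType) :
  exists n0 : nat, forall (n e : nat) (V : finType) (H : hypergraph 4 V),
    (n0 <= n)%N -> #|V| = n -> #|edges H| = e ->
    (n%:R : R) `^ (4 - 1 / 216) <= e%:R ->
    let s : R := 1 / 12 * (ln n%:R / ln (n%:R ^+ 4 / e%:R)) `^ (1 / 3) in
    let t : R := n%:R `^ (1 / 4) in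
    let m : R := 1 / 24 * (e%:R / n%:R) `^ (1 / 4) in
    has_disjoint_copies (nceil m) (K4 (nceil s) (nceil s) (nceil s) (nceil t)) H.
Proof.
(* Only n > 0 has to be imposed: the density hypothesis and q >= 24 already force n >= 24^216. *)
exists 1%N => n e V H n_gt0 Vn He dense s t m.
pose N : R := n%:R; pose E : R := e%:R.
have N0 : 0 < N by rewrite ltr0n.
have E0 : 0 < E by apply: lt_le_trans dense; rewrite powR_gt0.
pose q := N ^+ 4 / E.
have defq : N ^+ 4 = q * E by rewrite /q divfK // gt_eqF.
have q24 : 24 <= q.
  rewrite ler_pdivlMr //; have := card_edges_le H.
  by rewrite Vn He -(ler_nat R) natrM natrX.
have q0 : 0 < q by lra.
have lnq0 : 0 < ln q by rewrite ln_gt0 //; lra.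
(* The density hypothesis in logarithms, with ln q = 4 ln n - ln e. *)
have lnq : 216 * ln q <= ln N.
  have : ln (N `^ (4 - 1 / 216)) <= ln E by rewrite ler_ln // posrE powR_gt0.
  rewrite ln_powR /q ln_div ?posrE ?exprn_gt0 // lnXn // -[ln N *+ 4]mulr_natl.
  lra.
pose l := (ln N / ln q) `^ (1 / 3).
have l3 : l ^+ 3 = ln N / ln q.
  rewrite -powR_mulrn ?powR_ge0 // -powRrM mul1r mulVf // powRr1 // divr_ge0 //; lra.
(* The exponent 1/216 enters here, through 216 = 6^3. *)
have l6 : 6 <= l.
  rewrite -(@ler_pXn2r _ 3) ?nnegrE ?powR_ge0 // l3 ler_pdivlMr //.
  by apply: le_trans lnq; rewrite -natrX.
have ls : s = l / 12 by rewrite /s -/N -/E -/q -/l; field.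
set S := nceil s.
have S0 : (0 < S)%N by apply: nceil_gt0; lra.
(* If s <= 1 then S = 1 and [l6] suffices; otherwise S <= s + 1 <= 2s = l/6. *)
have Sl : 6 * S%:R <= l.
  case: (lerP s 1) => s1.
    suff -> : S = 1%N by lra.
    apply/eqP; rewrite eqn_leq S0 andbT -ltnS -(ltr_nat R).
    by apply: lt_le_trans (nceil_lt _) _; lra.
  by have := @nceil_lt _ s; rewrite -/S => /(_ _)/ltW; lra.
pose p := q ^+ (S ^ 3).
(* In logarithms this is (6S)^3 <= l^3, as p^216 = q^((6S)^3) and l^3 = ln n / ln q. *)
have pN : p ^+ 216 <= N.
  rewrite -ler_ln ?posrE ?exprn_gt0 // !lnXn ?exprn_gt0 //.
  rewrite -mulrnA -mulr_natl -ler_pdivlMr // -l3.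
  have -> : (S ^ 3 * 216)%:R = (6 * S%:R) ^+ 3 :> R by rewrite natrM natrX; ring.
  by rewrite lerXn2r ?nnegrE ?mulr_ge0 ?powR_ge0.
pose r := N `^ (1 / 4); pose u := (E / N) `^ (1 / 4).
have r4 : r ^+ 4 = N.
  by rewrite -powR_mulrn ?powR_ge0 // -powRrM mul1r mulVf // powRr1 // ltW.
have u4 : u ^+ 4 = E / N.
  rewrite -powR_mulrn ?powR_ge0 // -powRrM mul1r mulVf // powRr1 //.
  by rewrite divr_ge0 // ltW.
apply: (disjoint_copies_of_bounds (r := r) (u := u) (q := q)); rewrite ?Vn ?He //.
- exact: powR_ge0.
- exact: powR_ge0.
- by apply: nceil_gt0; apply: powR_gt0.
- by apply/ltW/nceil_lt/powR_ge0.
- have -> : u / 24 = m by rewrite /m -/u; field.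
  by apply/ltW/nceil_lt; rewrite /m mulr_ge0 ?powR_ge0.
Qed.
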